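(* Let $n\in\{2,3,\dots\}$. Then for all $\delta\in(n,n+1)$ $$u_n(\delta)<\frac{(n+1-\delta)\,\delta}{\delta-n}+\min\Bigl\{1,\;n+1-\delta+\tfrac12(n+1-\delta)^2\Bigr\}.$$
   Context: For $n\in\{1,2,\dots\}$ and $\delta\in(n,n+1)$, $u_n(\delta)$ denotes the unique positive solution $u$ of $$e^{-u}=1-\frac{u^1}{1!}+\dots+(-1)^{n-1}\frac{u^{n-1}}{(n-1)!}+(-1)^n\frac{\delta u^n}{n!\,(u+\delta)}.$$ *)

(* Defs.v *)
(* Stdlib reals and Coquelicot. *)
From Stdlib Require Import Reals Factorial.
From Coquelicot Require Import Coquelicot.

Open Scope R_scope.

(* Meant for n >= 1: the sum then runs over the exponents 0, ..., n - 1
   (sum_f_R0 includes its upper bound). *)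
Definition u_equation (n : nat) (delta u : R) : Prop :=
  exp (- u) =
    sum_f_R0 (fun k => (-1) ^ k * (u ^ k / INR (fact k))) (n - 1)
    + (-1) ^ n * ((delta * u ^ n) / (INR (fact n) * (u + delta))).

(* iota is definite description. For n >= 1 and n < delta < n + 1 exactly one
   u satisfies the predicate; outside that range the value is unspecified. *)
Definition u_ (n : nat) (delta : R) : R :=
  iota (fun u : R => 0 < u /\ u_equation n delta u).

(* Main.v *)
Require Import Defs.
From Stdlib Require Import Reals.
From Coquelicot Require Import Coquelicot.
From Stdlib Require Import ssreflect Lra Lia Factorial Ranalysis5.

Open Scope R_scope.

(** Let H(d, u) be the difference of the two sides of the defining equation,
    multiplied by (-1)^n e^u ([excess]); its zeros u > 0 are the solutions
    sought. Multiplying by e^u makes the Taylor sum telescope under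
    differentiation, so that along any differentiable path (D, U) only a
    rational factor decides the sign of the derivative
    ([is_derive_excess_path]):

      dH/dt = positive * (U' * ((D - n) U - (n + 1 - D) D) + D' * U).

    On a vertical path D = d this factor is (d - n) (u - A) with
    A = (n + 1 - d) d / (d - n), the first term of the bound. Hence H(d, .)
    starts from 0, decreases on [0, A] and increases afterwards: it has exactly
    one positive zero, and the zero lies below any b > A with H(d, b) > 0
    ([u_lt_of_excess_pos]).

    It remains to show H > 0 at the two points A + 1 and A + e + e^2/2, where
    e = n + 1 - d. Estimating H at fixed d would be delicate, because the
    bounds are asymptotically sharp, the quadratic one as e tends to 0 and the
    constant one as e tends to 1. Instead d moves: on a curve U(t) = A(t) + V(t),
    D(t) = n + 1 - t, the factor becomes U' (1 - t) V - U, because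
    U = A is exactly where its first bracket vanishes. So H increases along the
    curve as soon as U < U' (1 - t) V ([excess_barrier_pos]). For
    V = t + t^2/2 the curve starts at U = 0, where H = 0; for V = 1 it starts
    at U = 1, d = n + 1, where H > 0 since A = 0. In both cases the
    inequality is elementary and uses n >= 2. *)

(** * The normalised difference of the two sides *)

(** Since each partial sum S_m of the series of e^(-u) satisfies
    S_m' = - S_(m-1), only the last term survives. *)
Lemma is_derive_exp_mul_taylor (m : nat) (u : R) :
  is_derive
    (fun u => exp u * sum_f_R0 (fun k => (-1) ^ k * (u ^ k / INR (fact k))) m) u
    (exp u * ((-1) ^ m * (u ^ m / INR (fact m)))).
Proof.
induction m as [|m IH].
- simpl.
  auto_derive; [easy | lra].
- apply is_derive_ext with (fun u =>
    exp u * sum_f_R0 (fun k => (-1) ^ k * (u ^ k / INR (fact k))) m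
    + exp u * ((-1) ^ S m * (u ^ S m / INR (fact (S m))))).
  { intros t; rewrite tech5; simpl; ring. }
  evar_last.
  { apply: is_derive_plus; [exact IH |].
    auto_derive; [easy | reflexivity]. }
  unfold plus; simpl pred; simpl AbelianMonoid.plus.
  rewrite fact_simpl mult_INR.
  assert (INR (S m) <> 0) by (apply not_0_INR; lia).
  pose proof (INR_fact_neq_0 m).
  change (u ^ S m) with (u * u ^ m); change ((-1) ^ S m) with (-1 * (-1) ^ m).
  change (match m with 0%nat => 1 | S _ => INR m + 1 end) with (INR (S m)).
  field; auto.
Qed.

(** The factor (-1)^n makes the sign pattern the same for all n, and e^u removes
    the exponential from the derivative. *)
Definition excess (n : nat) (delta u : R) : R :=
  (-1) ^ n *
  (exp u *
     (sum_f_R0 (fun k => (-1) ^ k * (u ^ k / INR (fact k))) (n - 1)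
      + (-1) ^ n * ((delta * u ^ n) / (INR (fact n) * (u + delta)))) - 1).

Lemma pow_neg1_sq (n : nat) : (-1) ^ n * (-1) ^ n = 1.
Proof. rewrite <- Rpow_mult_distr; replace (-1 * -1) with 1 by ring; apply pow1. Qed.

Lemma excess_eq_0 (n : nat) (delta u : R) :
  excess n delta u = 0 <-> u_equation n delta u.
Proof.
unfold excess, u_equation; rewrite exp_Ropp.
set (r := sum_f_R0 _ _ + _).
pose proof (exp_pos u) as He.
pose proof (pow_neg1_sq n) as Hs.
split; intros H.
- apply Rmult_eq_reg_l with (exp u); [| lra].
  rewrite Rinv_r; [| lra].
  apply Rmult_integral in H as [H | H]; [| lra].
  rewrite H in Hs; lra.
- rewrite -H Rinv_r; lra.
Qed.

Lemma excess_at_0 (n : nat) (delta : R) : (1 <= n)%nat -> excess n delta 0 = 0.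
Proof.
intros hn; unfold excess.
assert (Hsum : forall m,
  sum_f_R0 (fun k => (-1) ^ k * (0 ^ k / INR (fact k))) m = 1).
{ induction m as [|m IH]; [simpl; lra |].
  rewrite tech5 IH pow_i; [lra | lia]. }
rewrite Hsum exp_0 pow_i; [| lia].
unfold Rdiv; ring.
Qed.

(** Two kinds of paths are of use: d fixed, to locate the zero, and d decreasing
    from n + 1, to follow a candidate upper bound for the zero. *)
Lemma is_derive_excess_path (n : nat) (D U : R -> R) (t D' U' : R) :
  (1 <= n)%nat -> U t + D t <> 0 -> is_derive D t D' -> is_derive U t U' ->
  is_derive (fun t => excess n (D t) (U t)) t
    (exp (U t) * U t ^ n / (INR (fact n) * (U t + D t) ^ 2)
     * (U' * ((D t - INR n) * U t - (INR n + 1 - D t) * D t) + D' * U t)).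
Proof.
intros hn Hne HD HU.
destruct n as [|m]; [lia |].
pose proof (INR_fact_neq_0 m) as Hf.
assert (HS : INR (S m) <> 0) by (apply not_0_INR; lia).
apply is_derive_ext with (fun t =>
  (-1) ^ S m *
    ((fun u => exp u * sum_f_R0 (fun k => (-1) ^ k * (u ^ k / INR (fact k))) m)
       (U t) - 1)
  + exp (U t) * (D t * U t ^ S m / (INR (fact (S m)) * (U t + D t)))).
{ intros s; unfold excess.
  replace (S m - 1)%nat with m by lia.
  pose proof (pow_neg1_sq (S m)) as Hs.
  set (e := (-1) ^ S m) in *; set (b := _ / (_ * _)).
  set (x := sum_f_R0 _ m).
  match goal with |- @eq _ ?a ?c => change (@eq R a c) end.
  transitivity (e * (exp (U s) * x - 1) + (e * e) * (exp (U s) * b)); [| ring].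
  rewrite Hs; cbv beta; fold x; ring. }
evar_last.
{ apply: is_derive_plus.
  - apply: is_derive_scal.
    apply: is_derive_minus; [| apply: is_derive_const].
    apply: (is_derive_comp (fun u => exp u *
      sum_f_R0 (fun k => (-1) ^ k * (u ^ k / INR (fact k))) m) U);
      [apply is_derive_exp_mul_taylor | exact HU].
  - auto_derive.
    + repeat split; try (eexists; eassumption).
      apply Rmult_integral_contrapositive_currified;
        [exact (INR_fact_neq_0 (S m)) | exact Hne].
    + reflexivity. }
rewrite (is_derive_unique (fun x => U x) _ _ HU)
  (is_derive_unique (fun x => D x) _ _ HD).
unfold plus, minus, opp, zero, scal; simpl.
change (match m with 0%nat => 1 | S _ => INR m + 1 end) with (INR (S m)).
change (INR (fact m + m * fact m)) with (INR (fact (S m))).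
rewrite fact_simpl mult_INR.
set (p := (-1) ^ m); set (q := U t ^ m / INR (fact m)).
(* The product and sum produced by the generic derivative lemmas live in an
   algebraic structure on R, which [ring] does not see through. *)
match goal with |- -1 * p * ?x + _ = _ =>
  change x with (U' * (exp (U t) * (p * q)) + - 0) end.
replace (-1 * p * (U' * (exp (U t) * (p * q)) + - 0))
  with (- (p * p) * (U' * exp (U t) * q)) by ring.
assert (Hp : p * p = 1) by apply pow_neg1_sq.
rewrite Hp; unfold q.
field; auto.
Qed.

(** * Monotonicity *)

(** The derivative of [excess] vanishes at u = 0, where the paths start, so it
    is required to be positive in the open interval only. *)
Lemma lt_of_deriv_pos (f f' : R -> R) (a b : R) :
  a < b ->
  (forall t, a <= t <= b -> is_derive f t (f' t)) ->
  (forall t, a < t < b -> 0 < f' t) -> f a < f b.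
Proof.
intros Hab Hd Hp.
destruct (MVT_cor2 f f' a b Hab) as [c [Hc Hcab]].
{ intros c Hc; apply is_derive_Reals, Hd, Hc. }
pose proof (Rmult_lt_0_compat _ (b - a) (Hp c Hcab)); lra.
Qed.

Lemma is_derive_excess (n : nat) (delta u : R) :
  (1 <= n)%nat -> u + delta <> 0 ->
  is_derive (excess n delta) u
    (exp u * u ^ n / (INR (fact n) * (u + delta) ^ 2)
     * ((delta - INR n) * u - (INR n + 1 - delta) * delta)).
Proof.
intros hn Hne.
evar_last.
- apply (is_derive_excess_path n (fun _ => delta) (fun u => u) u 0 1 hn Hne).
  + apply: is_derive_const.
  + apply: is_derive_id.
- simpl; ring.
Qed.

Lemma excess_weight_pos (n : nat) (delta u : R) :
  0 < u -> 0 < delta -> 0 < exp u * u ^ n / (INR (fact n) * (u + delta) ^ 2).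
Proof.
intros Hu Hd.
apply Rdiv_lt_0_compat; apply Rmult_lt_0_compat.
- apply exp_pos.
- now apply pow_lt.
- apply INR_fact_lt_0.
- apply pow_lt; lra.
Qed.

(** * Curves above the zero *)

(** With D = n + 1 - t and A = t (n + 1 - t) / (1 - t), which has derivative
    n / (1 - t)^2 + 1, the last hypothesis reads A + V < (A + V)' (1 - t) V: it
    is the condition for [excess] to increase along the curve u = A + V. *)
Lemma excess_barrier_pos (n : nat) (V V' : R -> R) (eps : R) :
  (1 <= n)%nat -> 0 < eps < 1 ->
  (forall t, 0 <= t <= eps -> is_derive V t (V' t)) ->
  (forall t, 0 <= t <= eps -> 0 <= V t) ->
  0 <= excess n (INR n + 1) (V 0) ->
  (forall t, 0 < t < eps ->
    t * (INR n + 1 - t) / (1 - t) + V t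
      < (INR n / (1 - t) ^ 2 + 1 + V' t) * (1 - t) * V t) ->
  0 < excess n (INR n + 1 - eps) (eps * (INR n + 1 - eps) / (1 - eps) + V eps).
Proof.
intros hn Heps HV HV0 Hstart Hsuper.
assert (Hn : 1 <= INR n) by (apply (le_INR 1); lia).
set (D := fun t => INR n + 1 - t).
set (U := fun t => t * (INR n + 1 - t) / (1 - t) + V t).
assert (HA : forall t, 0 <= t < 1 -> 0 <= t * (INR n + 1 - t) / (1 - t)).
{ intros t Ht; apply Rdiv_le_0_compat; [apply Rmult_le_pos |]; lra. }
assert (HA' : forall t, 0 < t < 1 -> 0 < t * (INR n + 1 - t) / (1 - t)).
{ intros t Ht; apply Rdiv_lt_0_compat; [apply Rmult_lt_0_compat |]; lra. }
assert (H : excess n (D 0) (U 0) < excess n (D eps) (U eps)).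
{ apply (lt_of_deriv_pos (fun t => excess n (D t) (U t)) (fun t =>
    exp (U t) * U t ^ n / (INR (fact n) * (U t + D t) ^ 2)
     * ((INR n / (1 - t) ^ 2 + 1 + V' t)
          * ((D t - INR n) * U t - (INR n + 1 - D t) * D t) + (-1) * U t)));
    [lra | |].
  - intros t Ht.
    apply is_derive_excess_path; [exact hn | | |].
    + unfold U, D; pose proof (HA t ltac:(lra)); pose proof (HV0 t ltac:(lra)); lra.
    + unfold D; auto_derive; [easy | ring].
    + apply: is_derive_plus; [| now apply HV].
      auto_derive; [lra | field; lra].
  - intros t Ht.
    apply Rmult_lt_0_compat.
    + apply excess_weight_pos; unfold U, D; [|lra].
      pose proof (HA' t ltac:(lra)); pose proof (HV0 t ltac:(lra)); lra.
    + replace ((D t - INR n) * U t - (INR n + 1 - D t) * D t)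
        with ((1 - t) * V t) by (unfold U, D; field; lra).
      pose proof (Hsuper t Ht); unfold U; lra. }
replace (D 0) with (INR n + 1) in H by (unfold D; ring).
replace (U 0) with (V 0) in H by (unfold U; field).
exact (Rle_lt_trans _ _ _ Hstart H).
Qed.

(** At the start of this curve, d = n + 1 and u = 1; there [excess] is positive
    because for d = n + 1 it increases on the whole half-line u >= 0. Along the
    curve, the two sides of the barrier condition differ by n - 2 t. *)
Lemma excess_barrier_one (n : nat) (eps : R) :
  (2 <= n)%nat -> 0 < eps < 1 ->
  0 < excess n (INR n + 1 - eps) (eps * (INR n + 1 - eps) / (1 - eps) + 1).
Proof.
intros hn Heps.
assert (Hn : 2 <= INR n) by (apply (le_INR 2); lia).
apply (excess_barrier_pos n (fun _ => 1) (fun _ => 0)); [lia | lra | | | |].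
- intros t _; apply: is_derive_const.
- intros; lra.
- rewrite -(excess_at_0 n (INR n + 1)); [| lia].
  apply Rlt_le.
  apply (lt_of_deriv_pos _ (fun u =>
    exp u * u ^ n / (INR (fact n) * (u + (INR n + 1)) ^ 2)
     * ((INR n + 1 - INR n) * u - (INR n + 1 - (INR n + 1)) * (INR n + 1))));
    [lra | |].
  + intros u Hu; apply is_derive_excess; [lia | lra].
  + intros u Hu; apply Rmult_lt_0_compat; [apply excess_weight_pos; lra | lra].
- intros t Ht; apply Rlt_0_minus.
  replace (_ - _) with (INR n - 2 * t) by (field; lra); lra.
Qed.

(** Along this curve, the two sides of the barrier condition differ by
    t^2 / (2 (1 - t)) times n - (1 - t) (1 + 3 t + t^2), and the polynomial
    stays below 2 on (0, 1). *)
Lemma excess_barrier_quadratic (n : nat) (eps : R) :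
  (2 <= n)%nat -> 0 < eps < 1 ->
  0 < excess n (INR n + 1 - eps)
        (eps * (INR n + 1 - eps) / (1 - eps) + (eps + 1 / 2 * eps ^ 2)).
Proof.
intros hn Heps.
assert (Hn : 2 <= INR n) by (apply (le_INR 2); lia).
apply (excess_barrier_pos n (fun t => t + 1 / 2 * t ^ 2) (fun t => 1 + t));
  [lia | lra | | | |].
- intros t _; auto_derive; [easy | lra].
- intros t Ht; pose proof (pow2_ge_0 t); lra.
- replace (0 + 1 / 2 * 0 ^ 2) with 0 by ring.
  rewrite excess_at_0; [lra | lia].
- intros t Ht; apply Rlt_0_minus.
  (* 2 - (1 - t) (1 + 3 t + t^2) = 2 (t - 1/2)^2 + 1/2 + t^3. *)
  replace (_ - _) with
    (t ^ 2 / (2 * (1 - t)) *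
       (INR n - 2 + (2 * (t - 1 / 2) ^ 2 + 1 / 2 + t ^ 3))) by (field; lra).
  apply Rmult_lt_0_compat.
  + apply Rdiv_lt_0_compat; [apply pow_lt |]; lra.
  + pose proof (pow2_ge_0 (t - 1 / 2)); pose proof (pow_lt t 3 ltac:(lra)); lra.
Qed.

(** * Locating the zero *)

(** For fixed d, [excess] vanishes at 0, decreases up to A and then increases,
    so it is negative on (0, A] and has one zero between A and b. This also
    gives the existence and uniqueness that the definite description needs. *)
Lemma u_lt_of_excess_pos (n : nat) (delta b : R) :
  (1 <= n)%nat -> INR n < delta < INR n + 1 ->
  (INR n + 1 - delta) * delta / (delta - INR n) < b -> 0 < excess n delta b ->
  u_ n delta < b.
Proof.
intros hn Hdelta; set (A := (_ * _) / _); intros HAb Hb.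
assert (Hn : 1 <= INR n) by (apply (le_INR 1); lia).
assert (HA : 0 < A).
{ apply Rdiv_lt_0_compat; [apply Rmult_lt_0_compat |]; lra. }
set (df := fun u => exp u * u ^ n / (INR (fact n) * (u + delta) ^ 2)
     * ((delta - INR n) * u - (INR n + 1 - delta) * delta)).
assert (Hdf : forall u, 0 <= u -> is_derive (excess n delta) u (df u)).
{ intros u Hu; apply is_derive_excess; [exact hn | lra]. }
assert (Hfac : forall u, (delta - INR n) * u - (INR n + 1 - delta) * delta
    = (delta - INR n) * (u - A)) by (intros u; unfold A; field; lra).
assert (Hneg : forall u, 0 < u <= A -> excess n delta u < 0).
{ intros u Hu.
  assert (- excess n delta 0 < - excess n delta u).
  { apply (lt_of_deriv_pos (fun u => - excess n delta u) (fun u => - df u));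
      [lra | |].
    - intros t Ht; apply: is_derive_opp; apply Hdf; lra.
    - intros t Ht; unfold df; rewrite Hfac Ropp_mult_distr_r.
      apply Rmult_lt_0_compat; [apply excess_weight_pos; lra |].
      rewrite Ropp_mult_distr_r.
      apply Rmult_lt_0_compat; lra. }
  rewrite excess_at_0 in H; [lra | exact hn]. }
assert (Hincr : forall u v, A <= u -> u < v -> excess n delta u < excess n delta v).
{ intros u v Hu Huv.
  apply (lt_of_deriv_pos _ df); [lra | |].
  - intros t Ht; apply Hdf; lra.
  - intros t Ht; unfold df; rewrite Hfac.
    apply Rmult_lt_0_compat; [apply excess_weight_pos; lra |].
    apply Rmult_lt_0_compat; lra. }
destruct (IVT_interv (excess n delta) A b) as [z [Hz Hz0]].
{ intros a Ha; apply derivable_continuous_pt; exists (df a).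
  apply is_derive_Reals, Hdf; lra. }
{ exact HAb. }
{ apply Hneg; lra. }
{ exact Hb. }
assert (Huniq : forall u, 0 < u -> excess n delta u = 0 -> z = u).
{ intros u Hu Hu0.
  destruct (Rle_lt_dec u A) as [HuA | HuA].
  { pose proof (Hneg u ltac:(lra)); lra. }
  destruct (Rtotal_order z u) as [H | [H | H]]; [| exact H |].
  - pose proof (Hincr z u ltac:(lra) ltac:(lra)); lra.
  - pose proof (Hincr u z ltac:(lra) ltac:(lra)); lra. }
assert (Hiota : 0 < u_ n delta /\ u_equation n delta (u_ n delta)).
{ apply (iota_correct (fun u => 0 < u /\ u_equation n delta u)).
  exists z; split.
  - split; [lra | now apply excess_eq_0].
  - intros u [Hu Hu0]; apply Huniq; [exact Hu | now apply excess_eq_0]. }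
destruct Hiota as [Hu Hu0].
rewrite <- (Huniq _ Hu); [| now apply excess_eq_0].
destruct (proj2 Hz) as [H | H]; [exact H |].
subst z; lra.
Qed.

Theorem proposition18 (n : nat) (hn : (2 <= n)%nat) (delta : R)
  (hdelta : INR n < delta < INR n + 1) :
  u_ n delta <
    (INR n + 1 - delta) * delta / (delta - INR n)
    + Rmin 1 (INR n + 1 - delta + 1 / 2 * (INR n + 1 - delta) ^ 2).
Proof.
set (eps := INR n + 1 - delta).
assert (Heps : 0 < eps < 1) by (unfold eps; lra).
replace delta with (INR n + 1 - eps) by (unfold eps; ring).
replace (INR n + 1 - eps - INR n) with (1 - eps) by ring.
apply u_lt_of_excess_pos; [lia | lra | |].
- replace (INR n + 1 - (INR n + 1 - eps)) with eps by ring.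
  replace (INR n + 1 - eps - INR n) with (1 - eps) by ring.
  pose proof (pow2_ge_0 eps).
  apply Rmin_case; lra.
- apply Rmin_case.
  + now apply excess_barrier_one.
  + now apply excess_barrier_quadratic.
Qed.
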